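(* Let $q\in(0,1]$ and $m>0$. Suppose that $\sup_{T\in\mathbb T}E[|\hat u_T|^m]<\infty$ where $\hat u_T=a_T^{-1}(\hat\theta_T-\theta^* )$, that [A6] holds (for every $j\in\mathcal J^{(0)}$, $(\xi_T^j)^{-1/q}|\alpha_T^j|^{-1}\to0$ in probability), and that as $T\to\infty$ $$(\tilde a_T^{(00)})^{-1}(\hat\theta_T^{(0)}-\theta^{*(0)})\to0\ \text{in probability},\qquad (\tilde a_T^{(11)})^{-1}(\hat\theta_T^{(1)}-\theta^{*(1)})\to(\Gamma^{(11)})^{-1}(\Delta^{(1)}-\psi^{(1)})\ \text{in distribution},$$ where $\Delta$ is a random vector in $\mathbb R^{\mathsf p}$, $\Gamma$ an almost surely positive definite random $\mathsf p\times\mathsf p$ matrix, and $\psi^{(1)}\in\mathbb R^{|\mathcal J^{(1)}|}$ a vector. Let $\tilde u_\infty\in\mathbb R^{\mathsf p}$ be the random vector with $\tilde u_\infty^{(0)}=0$ and $\tilde u_\infty^{(1)}=(\Gamma^{(11)})^{-1}(\Delta^{(1)}-\psi^{(1)})$. Then $$E[f(\hat u_T)]\to E[f(\tilde u_\infty)]\quad (T\to\infty)$$ for every continuous $f:\mathbb R^{\mathsf p}\to\mathbb R$ with $\limsup_{|u|\to\infty}|f(u)||u|^{-m}=0$.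
   Context: Let $\Theta\subset\mathbb R^{\mathsf p}$ be a bounded open set with closure $\overline\Theta$ and $\theta^*\in\Theta$. Let $(\Omega,\mathcal F,P)$ be a probability space, $\mathbb T\subset\mathbb R_{\ge0}$ with $\sup\mathbb T=\infty$; limits $T\to\infty$ are along $\mathbb T$. For each $T\in\mathbb T$, $\mathbb H_T:\Omega\times\overline\Theta\to\mathbb R$ is a random field continuous in $\theta$ for every $\omega$. The penalty is $p_T(\theta)=\sum_{j=1}^{\mathsf p}\xi_T^jp(\theta_j)$ with (possibly random) $\xi_T^j>0$ and $p:\mathbb R\to\mathbb R_{\ge0}$, $p(0)=0$; $\mathbb H^\dagger_T=\mathbb H_T-p_T$, and $\hat\theta_T:\Omega\to\overline\Theta$ is measurable with $\mathbb H^\dagger_T(\hat\theta_T)=\max_{\overline\Theta}\mathbb H^\dagger_T$. $\mathcal J^{(0)}=\{j:\theta^*_j=0\}$, $\mathcal J^{(1)}=\{j:\theta^*_j\ne0\}$; $x^{(k)}=(x_j)_{j\in\mathcal J^{(k)}}$, $A^{(kl)}=(A_{ij})_{i\in\mathcal J^{(k)},j\in\mathcal J^{(l)}}$. $a_T=\mathrm{diag}(\alpha_T^1,\dots,\alpha_T^{\mathsf p})$ is deterministic, invertible, with $\|a_T\|\to0$. $\tilde a_T$ is diagonal with $(\tilde a_T)_{jj}=(\xi_T^j)^{-1/q}$ for $j\in\mathcal J^{(0)}$ and $\alpha_T^j$ for $j\in\mathcal J^{(1)}$. *)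

(* Defs.v *)
From HB Require Import structures.
From mathcomp Require Import all_boot all_order all_algebra.
From mathcomp Require Import all_classical all_reals all_analysis.
Set Implicit Arguments. Unset Strict Implicit. Unset Printing Implicit Defensive.
Import Order.TTheory GRing.Theory Num.Theory.
Import numFieldNormedType.Exports.
Local Open Scope classical_set_scope.
Local Open Scope ring_scope.

Definition enorm {R : realType} {n : nat} (u : 'rV[R]_n) : R :=
  Num.sqrt (\sum_(j < n) u ord0 j ^+ 2).

Definition enorm_on {R : realType} {n : nat} (J : {set 'I_n}) (u : 'rV[R]_n) : R :=
  Num.sqrt (\sum_(j in J) u ord0 j ^+ 2).

(* the limit T -> oo along the index set S (sup S = oo) *)
Definition along {R : realType} (S : set R) : set_system R :=
  [set A | exists T0 : R, forall T, S T -> T0 <= T -> A T].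

Definition cvg_along {R : realType} {Y : topologicalType} (S : set R)
  (g : R -> Y) (l : Y) : Prop :=
  forall A, nbhs l A -> along S (g @^-1` A).

Definition cvg_prob0 {d} {Om : measurableType d} {R : realType}
  (P : probability Om R) (S : set R) (X : R -> Om -> R) : Prop :=
  forall eps : R, 0 < eps ->
    cvg_along S (fun T => P [set w | eps < `| X T w |]) 0%E.

Definition cvg_dist {d d'} {Om : measurableType d} {Om' : measurableType d'}
  {R : realType} {k : nat} (P : probability Om R) (P' : probability Om' R)
  (S : set R) (X : R -> Om -> 'rV[R]_k) (Y : Om' -> 'rV[R]_k) : Prop :=
  forall g : 'rV[R]_k -> R, continuous g ->
    (exists M : R, forall v, `| g v | <= M) ->
    cvg_along S (fun T => (\int[P]_w (g (X T w))%:E)%E) (\int[P']_w (g (Y w))%:E)%E.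

Definition posdef {R : realType} {n : nat} (A : 'M[R]_n) : Prop :=
  A^T = A /\ forall v : 'rV[R]_n, v != 0 -> 0 < (v *m A *m v^T) ord0 ord0.

Definition subv {R : realType} {n : nat} (J : {set 'I_n}) (u : 'rV[R]_n)
  : 'rV[R]_#|J| := \row_(i < #|J|) u ord0 (enum_val i).

Definition subm {R : realType} {n : nat} (J : {set 'I_n}) (A : 'M[R]_n)
  : 'M[R]_#|J| := \matrix_(i < #|J|, k < #|J|) A (enum_val i) (enum_val k).

Definition extv {R : realType} {n : nat} (J : {set 'I_n}) (v : 'rV[R]_#|J|)
  : 'rV[R]_n :=
  \row_(j < n) (match boolP (j \in J) with
               | AltTrue h => v ord0 (enum_rank_in h j)
               | AltFalse _ => 0 end).
Arguments extv {R n} J v.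

(* Main.v *)
Require Import Defs.
From HB Require Import structures.
From mathcomp Require Import all_boot all_order all_algebra.
From mathcomp Require Import all_classical all_reals all_analysis.
From mathcomp Require Import measurable_realfun lra ring.
Import Order.TTheory GRing.Theory Num.Theory.
Import numFieldNormedType.Exports.
Local Open Scope classical_set_scope.
Local Open Scope ring_scope.
Set Implicit Arguments. Unset Strict Implicit. Unset Printing Implicit Defensive.

(** Clamping every coordinate to [[-K, K]] turns a continuous [f] into a bounded
    and uniformly continuous function [f \o clamp K]. Let [V_T] be [uhat_T] with
    the coordinates in [J0] set to zero; by [A6] and the first convergence the
    difference [uhat_T - V_T] tends to [0] in probability, so
    [E f(clamp K uhat_T)] and [E f(clamp K V_T)] have the same limit, which the
    convergence in distribution identifies as [E f(clamp K utilde)]. Applied to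
    [f = |.|^m], with [K -> oo] and Fatou's lemma, this bounds [E |utilde|^m] by
    the same constant as [E |uhat_T|^m]. The growth condition gives
    [|f u - f (clamp K u)| <= 2 eps |u|^m] for large [K], so replacing [f] by
    [f \o clamp K] costs at most [2 eps C] on both sides, uniformly in [T]. *)

Definition clamp {R : realType} {n : nat} (K : R) (u : 'rV[R]_n) : 'rV[R]_n :=
  \row_j Num.max (- K) (Num.min (u ord0 j) K).

(** * Measurability of continuous functions of a random vector *)

(** The preimage of an open interval under [h] is open, hence a countable union of rational cubes,
    and membership of [X] in a cube is a finite conjunction of conditions on measurable
    coordinates. *)
Lemma measurable_fun_continuous_rV {d} {T : measurableType d} {R : realType}
    {n : nat} (h : 'rV[R]_n -> R) (X : T -> 'rV[R]_n) :
  continuous h -> (forall j, measurable_fun setT (fun w => X w ord0 j)) ->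
  measurable_fun setT (fun w => h (X w)).
Proof.
move=> /continuousP ch mX.
apply: (measurability _ (RGenOpens.measurableE R)).
move=> _ [_ [a [b ->] <-]]; rewrite setTI.
have oU : open (h @^-1` `]a, b[%classic) by exact/ch/interval_open.
set U := h @^-1` _ in oU.
(* [B cr] is the event that [X] lies in the open cube of centre [cr.1] and radius [cr.2]; [good cr]
   says that this cube is contained in [U]. *)
pose B (cr : 'rV[rat]_n * rat) : set T :=
  \bigcap_(j in [set: 'I_n])
    [set w | `|X w ord0 j - ratr (cr.1 ord0 j)| < ratr cr.2].
pose good (cr : 'rV[rat]_n * rat) := forall v : 'rV[R]_n,
  (forall j, `|v ord0 j - ratr (cr.1 ord0 j)| < ratr cr.2) -> U v.
rewrite (_ : _ @^-1` _ = \bigcup_(cr in [set: 'rV[rat]_n * rat])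
    (if `[<good cr>] then B cr else set0)); last first.
  apply/seteqP; split => w /=.
  - move=> Uw; have /nbhs_ballP[e /= e0 eU] : nbhs (X w) U.
      by apply: open_nbhs_nbhs; split.
    have [r] := @rat_in_itvoo R 0 (e / 2) ltac:(by rewrite divr_gt0).
    rewrite in_itv/= => /andP[r0 re].
    have /choice[c Hc] : forall j : 'I_n, exists c : rat,
        `|X w ord0 j - ratr c| < ratr r.
      move=> j; have [c] := @rat_in_itvoo R (X w ord0 j - ratr r)
        (X w ord0 j + ratr r) ltac:(by lra).
      rewrite in_itv/= => /andP[c1 c2]; exists c.
      by rewrite ltr_norml; apply/andP; split; lra.
    exists (\row_j c j, r) => //; case: asboolP => [_ j _|].
      by rewrite /= mxE.
    (* Both [X w] and [v] are within [r < e / 2] of the rational centre, hence within [e] of each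
       other. *)
    case=> v /= Hv; apply: eU; split => // i j; rewrite (ord1 i).
    have := Hv j; rewrite mxE /ball/= => Hv'.
    rewrite (_ : _ - _ = (X w ord0 j - ratr (c j)) - (v ord0 j - ratr (c j)));
      last by ring.
    apply: le_lt_trans (ler_normB _ _) _.
    by have := Hc j; lra.
  - by case=> cr _; case: asboolP => // gcr Bw; apply: gcr => j; exact: Bw.
apply: countable_bigcupT_measurable => // cr; case: ifP => // _.
apply: fin_bigcap_measurable => // j _.
rewrite -[X in measurable X]setTI.
rewrite (_ : [set w | _] = (fun w => `|X w ord0 j - ratr (cr.1 ord0 j)|) @^-1`
  `]-oo, (ratr cr.2 : R)[%classic); last first.
  by apply/seteqP; split => w /=; rewrite in_itv.
have mf : measurable_fun setT (fun w => `|X w ord0 j - ratr (cr.1 ord0 j)|).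
  apply: measurableT_comp => //; exact: measurable_funB.
exact: mf.
Qed.

(** * Clamping to a cube; continuity of norms and their powers *)

Lemma clampr_lipschitz {R : realType} (K a b : R) :
  `|Num.max (- K) (Num.min a K) - Num.max (- K) (Num.min b K)| <= `|a - b|.
Proof.
wlog ab : a b / a <= b.
  move=> W; have [/W//|/ltW/W] := leP a b.
  by rewrite distrC [leRHS]distrC.
rewrite distrC [leRHS]distrC.
have H : 0 <= Num.max (- K) (Num.min b K) - Num.max (- K) (Num.min a K) <= b - a.
  rewrite !minEle !maxEle.
  by repeat case: ifPn; rewrite -?ltNge => *; apply/andP; split; lra.
case/andP : H => H1 H2; rewrite !ger0_norm//; lra.
Qed.

Section clamp.
Context {R : realType} {n : nat}.
Implicit Types (K : R) (u v : 'rV[R]_n).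

Lemma compact_cube K :
  compact [set u : 'rV[R]_n | forall j, `[- K, K]%classic (u ord0 j)].
Proof.
by apply: (@rV_compact _ _ (fun=> `[- K, K]%classic)) => _; exact: segment_compact.
Qed.

Lemma clamp_in_cube K u : 0 <= K -> forall j, `[- K, K]%classic (clamp K u ord0 j).
Proof.
move=> K0 j /=; rewrite in_itv/= mxE le_max lexx/= ge_max.
by rewrite ge_min lexx orbT andbT; lra.
Qed.

Lemma clamp_bounded (h : 'rV[R]_n -> R) K : continuous h -> 0 <= K ->
  exists M, forall u, `|h (clamp K u)| <= M.
Proof.
move=> ch K0.
have /compact_bounded[M [_ HM]] := continuous_compact
  (continuous_subspaceT ch) (@compact_cube K).
exists (M + 1) => u; apply: HM; first by rewrite ltrDl.
by exists (clamp K u) => // j; exact: clamp_in_cube.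
Qed.

(** Heine-Cantor on the compact cube, through the near-covering form of compactness. Clamping does
    not increase coordinate distances, so closeness is asked only of the unclamped vectors, which
    range over the whole space. *)
Lemma clamp_uniform (h : 'rV[R]_n -> R) K (e : R) : continuous h -> 0 <= K -> 0 < e ->
  exists2 dt, 0 < dt & forall u v, (forall j, `|u ord0 j - v ord0 j| < dt) ->
    `|h (clamp K u) - h (clamp K v)| <= e.
Proof.
move=> ch K0 e0.
have /compact_near_coveringP cK := @compact_cube K.
have := cK _ (0^'+ : set_system R) (fun dt x => forall y : 'rV[R]_n,
  (forall j, `|x ord0 j - y ord0 j| < dt) -> `|h x - h y| <= e) _.
case.
  move=> x _.
  have /cvgrPdist_lt/(_ (e / 2)) := ch x; rewrite divr_gt0// => /(_ isT).
  move=> /nbhs_ballP[r /= r0 Hr].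
  (* With these radii [x'] and every [y] that is [dt]-close to it lie within [r] of [x], so [h]
     varies by less than [e / 2] from [h x] at each. *)
  exists (ball x (r / 2), [set dt | dt < r / 2]) => /=.
    split; first by apply: nbhsx_ballx; rewrite divr_gt0.
    by apply: nbhs_right_lt; rewrite divr_gt0.
  move=> [x' dt] /= [[_ xx'] dtr] y xy.
  have H1 : `|h x - h x'| < e / 2.
    apply: Hr; split => // i j; have := xx' i j; rewrite /ball/= => H.
    by apply: lt_trans H _; lra.
  have H2 : `|h x - h y| < e / 2.
    apply: Hr; split => // i j; have := xx' i j; rewrite (ord1 i) /ball/= => H.
    rewrite (_ : _ - _ = (x ord0 j - x' ord0 j) + (x' ord0 j - y ord0 j));
      last by ring.
    apply: le_lt_trans (ler_normD _ _) _; have := xy j; lra.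
  rewrite (_ : _ - _ = (h x - h y) - (h x - h x')); last by ring.
  by apply: le_trans (ler_normB _ _) _; lra.
move=> dt /= dt0 Hdt; exists (dt / 2) => /=; first by rewrite divr_gt0.
move=> u v uv.
apply: (Hdt (dt / 2)).
- by rewrite /ball/= sub0r normrN gtr0_norm ?divr_gt0//; lra.
- by rewrite divr_gt0.
- by move=> j; exact: clamp_in_cube.
by move=> j; apply: le_lt_trans (uv j); rewrite !mxE; exact: clampr_lipschitz.
Qed.

Lemma continuous_clamp (h : 'rV[R]_n -> R) K : continuous h -> 0 <= K ->
  continuous (fun u => h (clamp K u)).
Proof.
move=> ch K0 u; apply/(@cvgrPdist_le _ _ _ (nbhs u)) => e e0.
have [dt dt0 Hdt] := clamp_uniform ch K0 e0.
apply/nbhs_ballP; exists dt => //= v [_ uv]; apply: Hdt => j; exact: uv.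
Qed.

Lemma sqr_clamp_le K u j : 0 <= K -> clamp K u ord0 j ^+ 2 <= u ord0 j ^+ 2.
Proof.
move=> K0; rewrite -[leLHS]real_normK ?num_real// -[leRHS]real_normK ?num_real//.
rewrite lerXn2r ?nnegrE// mxE; have := clampr_lipschitz K (u ord0 j) 0.
rewrite subr0 [Num.min 0 K]min_l// [Num.max (- K) 0]max_r ?subr0//; lra.
Qed.

Lemma enorm_clamp_le K u : 0 <= K -> enorm (clamp K u) <= enorm u.
Proof.
by move=> K0; rewrite ler_wsqrtr//; apply: ler_sum => j _; exact: sqr_clamp_le.
Qed.

Lemma normr_le_enorm u j : `|u ord0 j| <= enorm u.
Proof.
rewrite -sqrtr_sqr ler_wsqrtr// (bigD1 j)//= lerDl.
by apply: sumr_ge0 => i _; exact: sqr_ge0.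
Qed.

Lemma clamp_id K u : (forall j, `|u ord0 j| <= K) -> clamp K u = u.
Proof.
move=> uK; apply/rowP => j; rewrite mxE; have := uK j.
by rewrite ler_norml => /andP[? ?]; rewrite min_l// max_r.
Qed.

(** A changed coordinate exceeds [K] in absolute value and is moved to [K] or [-K]. So wherever
    clamping acts, the vector and its image both lie in the region of the growth bound. *)
Lemma enorm_clamp_ge K u : 0 <= K -> clamp K u != u -> K <= enorm (clamp K u).
Proof.
move=> K0 /eqP uK.
have [j uj] : exists j, K < `|u ord0 j|.
  apply: contra_notP uK => /forallNP uK; apply: clamp_id => j.
  by rewrite leNgt; exact/negP.
apply: le_trans (normr_le_enorm _ j); rewrite mxE.
move: uj; rewrite real_ltr_normr ?num_real// => /orP[uj|uj].
  by rewrite min_r ?(ltW uj)// max_r ?ger0_norm//; lra.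
by rewrite min_l; [rewrite max_l ?normrN ?ger0_norm//|]; lra.
Qed.

Lemma enorm_ge0 u : 0 <= enorm u.
Proof. exact: sqrtr_ge0. Qed.

Lemma continuous_sum_coord_sqr (J : {pred 'I_n}) :
  continuous (fun u : 'rV[R]_n => \sum_(j in J) u ord0 j ^+ 2).
Proof.
move=> u; apply: (@cvg_big _ _ _ _ _ _ _ (nbhs u)) => //; first exact: add_continuous.
move=> j _; apply: (@continuous_comp 'rV[R]_n _ _ (fun u : 'rV[R]_n => u ord0 j)
  (fun x : R => x ^+ 2)).
  exact: coord_continuous.
exact: exprn_continuous.
Qed.

Lemma continuous_enorm_on (J : {set 'I_n}) :
  continuous (fun u : 'rV[R]_n => enorm_on J u).
Proof.
move=> u; apply: (@continuous_comp _ _ _ (fun u : 'rV[R]_n =>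
  \sum_(j in J) u ord0 j ^+ 2) Num.sqrt).
  exact: continuous_sum_coord_sqr.
exact: sqrt_continuous.
Qed.

Lemma continuous_enorm : continuous (fun u : 'rV[R]_n => enorm u).
Proof.
rewrite (_ : (fun u => enorm u) = enorm_on [set: 'I_n]%SET).
  exact: continuous_enorm_on.
by apply/funext => u; rewrite /enorm_on; under eq_bigl do rewrite inE.
Qed.

Lemma continuous_powR_ge0 (g : 'rV[R]_n -> R) m : 0 < m ->
  continuous g -> (forall u, 0 <= g u) -> continuous (fun u => g u `^ m).
Proof.
move=> m0 cg g0 u; have [gu0|gu0] := eqVneq (g u) 0.
  apply/(@cvgrPdist_lt _ _ _ (nbhs u)) => e e0; rewrite gu0 powR0 ?gt_eqF//.
  have /cvgrPdist_lt/(_ (e `^ m^-1)) := cg u.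
  rewrite powR_gt0// => /(_ isT); apply: filterS => v.
  rewrite gu0 !sub0r !normrN !ger0_norm ?powR_ge0// => gv.
  have -> : e = (e `^ m^-1) `^ m.
    by rewrite -powRrM mulVf ?gt_eqF// powRr1// ltW.
  by rewrite gt0_ltr_powR ?nnegrE ?powR_ge0.
have gup : 0 < g u by rewrite lt_def gu0 g0.
apply: (@cvg_trans _ ((fun v => expR (m * ln (g v))) @ u)).
  apply: (@near_eq_cvg _ _ (nbhs u)).
  have /cvgrPdist_lt/(_ (g u)) := cg u; rewrite gup => /(_ isT).
  apply: filterS => v; rewrite ltr_norml => /andP[_ gv].
  have gv0 : 0 < g v by lra.
  by rewrite /powR gt_eqF.
rewrite /powR gt_eqF//.
apply: (@continuous_comp _ _ _ (fun v => m * ln (g v)) expR); last exact: continuous_expR.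
apply: (@cvgM _ _ (nbhs u)); first exact: cvg_cst.
exact: (cvg_comp _ _ (cg u) (continuous_ln gup)).
Qed.
End clamp.

(** * The filter of limits along the index set *)

#[global] Instance along_filter {R : realType} (S : set R) : Filter (along S).
Proof.
split.
- by exists 0.
- move=> A B [a Ha] [b Hb]; exists (Num.max a b) => T ST.
  by rewrite ge_max => /andP[aT bT]; split; [exact: Ha|exact: Hb].
- by move=> A B AB [a Ha]; exists a => T ST aT; exact/AB/Ha.
Qed.

(** Finiteness on [S] holds eventually along the filter, so convergence in the extended reals can be
    read off the real parts in epsilon form. *)
Lemma cvg_alongP {R : realType} (S : set R) (g : R -> \bar R) (l : R) :
  (forall T, S T -> g T \is a fin_num) ->
  cvg_along S g l%:E <->
  forall e, 0 < e -> along S [set T | `|l - fine (g T)| <= e].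
Proof.
move=> gfin; rewrite -[cvg_along _ _ _]/(g @ along S --> l%:E); split.
  by move=> /fine_cvgP[_ /cvgrPdist_le].
move=> H; apply/fine_cvgP; split; first by exists 0 => T ST _; exact: gfin.
exact/cvgrPdist_le.
Qed.

(** * Comparison of expectations *)

Section prob.
Context {d} {T : measurableType d} {R : realType} (P : probability T R).

Lemma integrable_bounded (f : T -> R) (M : R) : measurable_fun setT f ->
  (forall w, `|f w| <= M) -> P.-integrable setT (EFin \o f).
Proof.
move=> mf fM; apply: measurable_bounded_integrable => //.
  by apply: le_lt_trans (probability_le1 P measurableT) _; exact: ltry.
exists M; split; first exact: num_real.
by move=> x Mx w _; apply: le_trans (fM w) _; exact: ltW.
Qed.

Lemma dist_Rintegral_le (f1 f2 g : T -> R) :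
  P.-integrable setT (EFin \o f1) -> P.-integrable setT (EFin \o f2) ->
  P.-integrable setT (EFin \o g) -> (forall w, `|f1 w - f2 w| <= g w) ->
  `|\int[P]_w f1 w - \int[P]_w f2 w| <= \int[P]_w g w.
Proof.
move=> i1 i2 ig fg; rewrite -RintegralB//.
have iB : P.-integrable setT (EFin \o (fun w => f1 w - f2 w)).
  by have := integrableB measurableT i1 i2; apply: eq_integrable => // w _.
apply: le_trans (le_normr_Rintegral _ _) _ => //.
apply: le_Rintegral => //.
by have := integrable_abse iB; apply: eq_integrable.
Qed.

Lemma measurable_superlevel (f : T -> R) (a : R) : measurable_fun setT f ->
  measurable [set w | a < `|f w|].
Proof.
move=> mf; rewrite -[X in measurable X]setTI.
rewrite (_ : [set w | _] = (fun w => `|f w|) @^-1` `]a, +oo[%classic); last first.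
  by apply/seteqP; split => w /=; rewrite in_itv/= andbT.
have mg : measurable_fun setT (fun w => `|f w|) by exact: measurableT_comp.
exact: mg.
Qed.

(** On the event [B] that [|D|] exceeds [dt] the integrands differ by at most [2 M], and off it by
    at most [e]; the bound is the integral of [e + 2 M 1_B]. *)
Lemma dist_Rintegral_le_prob (f1 f2 D : T -> R) (M e dt : R) :
  measurable_fun setT f1 -> measurable_fun setT f2 -> measurable_fun setT D ->
  (forall w, `|f1 w| <= M) -> (forall w, `|f2 w| <= M) -> 0 <= e ->
  (forall w, `|D w| <= dt -> `|f1 w - f2 w| <= e) ->
  `|\int[P]_w f1 w - \int[P]_w f2 w| <=
    e + 2 * M * fine (P [set w | dt < `|D w|]).
Proof.
move=> m1 m2 mD b1 b2 e0 H.
set B := [set w | _].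
have mB : measurable B by exact: measurable_superlevel.
have i1 := integrable_bounded m1 b1; have i2 := integrable_bounded m2 b2.
have iB : P.-integrable setT (EFin \o (fun w => 2 * M * \1_B w)).
  apply: (@integrable_bounded _ `|2 * M|).
    by apply: measurable_funM => //; exact: measurable_indic.
  move=> w; rewrite normrM indicE; case: (w \in B); rewrite ?normr1 ?mulr1//.
  by rewrite normr0 mulr0.
have ie : P.-integrable setT (EFin \o (fun=> e)).
  by apply: (@integrable_bounded _ `|e|) => //; exact: measurable_cst.
have -> : e + 2 * M * fine (P B) = \int[P]_w (e + 2 * M * \1_B w).
  rewrite RintegralD// Rintegral_cst//= probability_setT/= mulr1; congr (_ + _).
  rewrite RintegralZl//; last first.
    apply: (@integrable_bounded _ 1); first exact: measurable_indic.
    by move=> w; rewrite indicE; case: (w \in B); rewrite ?normr1 ?normr0.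
  by rewrite /Rintegral integral_indic// setIT.
apply: dist_Rintegral_le => //.
  have := integrableD measurableT ie iB; apply: eq_integrable => // w _.
move=> w; rewrite indicE; case: (boolP (w \in B)) => [_|/negP wB].
  rewrite mulr1; apply: le_trans (ler_normB _ _) _.
  by have := b1 w; have := b2 w; lra.
rewrite mulr0 addr0; apply: H; rewrite leNgt; apply/negP => wB'.
by apply: wB; rewrite inE.
Qed.

End prob.

(** * Convergence in probability to zero *)

Section cvg_prob0.
Context {d} {Om : measurableType d} {R : realType} (P : probability Om R).
Variable S : set R.
Implicit Types X Y : R -> Om -> R.

(** Only indices in [S] are constrained, since the data of the theorem are arbitrary elsewhere. *)
Definition measurable_along X := forall T, S T -> measurable_fun setT (X T).

Lemma cvg_prob0P X : measurable_along X -> cvg_prob0 P S X <->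
  forall eps eta, 0 < eps -> 0 < eta ->
    along S [set T | fine (P [set w | eps < `|X T w|]) <= eta].
Proof.
move=> mX.
have fP eps T : S T -> P [set w | eps < `|X T w|] \is a fin_num.
  by move=> ST; exact/fin_num_measure/measurable_superlevel/mX.
split=> H.
  move=> eps eta eps0 eta0.
  have /(cvg_alongP 0 (fP eps))/(_ eta eta0)[T0 HT0] := H eps eps0.
  exists T0 => T ST T0T; have := HT0 T ST T0T.
  by rewrite /= sub0r normrN ger0_norm// fine_ge0.
move=> eps eps0; apply/cvg_alongP => [T /fP//|eta eta0].
have [T0 HT0] := H eps eta eps0 eta0; exists T0 => T ST T0T.
by rewrite /= sub0r normrN ger0_norm ?fine_ge0//; exact: HT0.
Qed.

(** Common source for sums, products and domination: if the two thresholds [phi eps] force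
    [|Z| <= eps], a large [Z] requires a large [X] or a large [Y], and a union bound concludes. *)
Lemma cvg_prob0_sub X Y Z (phi : R -> R * R) :
  measurable_along X -> measurable_along Y -> measurable_along Z ->
  (forall eps, 0 < eps -> [/\ 0 < (phi eps).1, 0 < (phi eps).2 & forall T w,
     S T -> `|X T w| <= (phi eps).1 -> `|Y T w| <= (phi eps).2 -> `|Z T w| <= eps]) ->
  cvg_prob0 P S X -> cvg_prob0 P S Y -> cvg_prob0 P S Z.
Proof.
move=> mX mY mZ H /(cvg_prob0P mX) cX /(cvg_prob0P mY) cY.
apply/(cvg_prob0P mZ) => eps eta eps0 eta0.
have [h1 h2 HZ] := H eps eps0.
have eta20 : 0 < eta / 2 by rewrite divr_gt0.
have {}cX := cX _ _ h1 eta20; have {}cY := cY _ _ h2 eta20.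
(* Membership in [S] is itself an eventual property, so it can be intersected with the two
   bounds. *)
have ST : along S S by exists 0.
apply: filterS3 ST cX cY => T ST /= PX PY.
set A := [set w | _ < `|X T w|] in PX; set B := [set w | _ < `|Y T w|] in PY.
have mA : measurable A by exact/measurable_superlevel/mX.
have mB : measurable B by exact/measurable_superlevel/mY.
set C := [set w | _ < `|Z T w|].
have mC : measurable C by exact/measurable_superlevel/mZ.
have PAB : (P C <= P A + P B)%E.
  apply: le_trans (measureU2 _ _ _) => //; apply: le_measure; rewrite ?inE//.
    exact: measurableU.
  move=> w /= eZ; apply: contrapT => /not_orP[] /negP; rewrite -leNgt => XA.
  move=> /negP; rewrite -leNgt => YB.
  by have := HZ T w ST XA YB; rewrite leNgt eZ.
have : fine (P C) <= fine (P A + P B).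
  by rewrite fine_le// ?fin_numD ?fin_num_measure.
rewrite fineD ?fin_num_measure//; lra.
Qed.

Lemma cvg_prob0D X Y : measurable_along X -> measurable_along Y ->
  cvg_prob0 P S X -> cvg_prob0 P S Y -> cvg_prob0 P S (fun T w => X T w + Y T w).
Proof.
move=> mX mY; apply: (@cvg_prob0_sub _ _ _ (fun e => (e / 2, e / 2))) => //.
  by move=> T ST; apply: measurable_funD; [exact: mX|exact: mY].
move=> e e0; split=> /=; [lra|lra|].
by move=> T w _ Xe Ye; apply: le_trans (ler_normD _ _) _; lra.
Qed.

Lemma cvg_prob0M X Y : measurable_along X -> measurable_along Y ->
  cvg_prob0 P S X -> cvg_prob0 P S Y -> cvg_prob0 P S (fun T w => X T w * Y T w).
Proof.
move=> mX mY; apply: (@cvg_prob0_sub _ _ _ (fun e => (1, e))) => //.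
  by move=> T ST; apply: measurable_funM; [exact: mX|exact: mY].
move=> e e0; split=> //= T w _ X1 Ye.
by rewrite normrM -[leRHS]mul1r ler_pM.
Qed.

Lemma cvg_prob0_le X Y : measurable_along X -> measurable_along Y ->
  (forall T w, S T -> `|Y T w| <= `|X T w|) -> cvg_prob0 P S X -> cvg_prob0 P S Y.
Proof.
move=> mX mY XY cX.
apply: (@cvg_prob0_sub X X Y (fun e => (e, e))) => //.
by move=> e e0; split=> //= T w ST Xe _; exact: le_trans (XY T w ST) Xe.
Qed.

Lemma cvg_prob0_sum (I : finType) (X : I -> R -> Om -> R) :
  (forall i, measurable_along (X i)) -> (forall i, cvg_prob0 P S (X i)) ->
  cvg_prob0 P S (fun T w => \sum_i X i T w).
Proof.
move=> mX cX; elim: (index_enum I) => [|i s IHs].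
  apply/cvg_prob0P => [T ST|e eta e0 eta0].
    by under eq_fun do rewrite big_nil; exact: measurable_cst.
  exists 0 => T _ _ /=.
  rewrite (_ : [set w | _] = set0) ?measure0 ?ltW//.
  by apply/seteqP; split => // w; rewrite /= big_nil normr0 ltNge ltW.
have -> : (fun T w => \sum_(j <- i :: s) X j T w) =
    (fun T w => X i T w + \sum_(j <- s) X j T w).
  by apply/funext => T; apply/funext => w; rewrite big_cons.
apply: cvg_prob0D => //; move=> T ST; apply: measurable_sum => j; exact: mX.
Qed.

End cvg_prob0.

Lemma integral_fin_num {d} {T : measurableType d} {R : realType}
    (P : probability T R) (f : T -> R) :
  P.-integrable setT (EFin \o f) -> (\int[P]_w (f w)%:E)%E \is a fin_num.
Proof. by move=> /integrable_fin_num; apply. Qed.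

(** * Limits of clamped expectations and of moments *)

Section limits.
Context {R : realType} {n : nat} {d d' : measure_display}.
Context {Om : measurableType d} {Om' : measurableType d'}.
Variables (P : probability Om R) (P' : probability Om' R) (S : set R).
Implicit Types (h : 'rV[R]_n -> R).

Definition measurable_rV {d} {Om : measurableType d} (Z : Om -> 'rV[R]_n) :=
  forall j, measurable_fun setT (fun w => Z w ord0 j).

Lemma integrable_clamp {d0} {Om0 : measurableType d0} (Q : probability Om0 R)
    (Z : Om0 -> 'rV[R]_n) h K : continuous h -> 0 <= K -> measurable_rV Z ->
  Q.-integrable setT (EFin \o (fun w => h (clamp K (Z w)))).
Proof.
move=> ch K0 mZ; have [M HM] := clamp_bounded ch K0.
apply: (@integrable_bounded _ _ _ _ _ M) => //.
exact: (measurable_fun_continuous_rV (continuous_clamp ch K0)).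
Qed.

(** A Slutsky argument. Where [X] and [V] are close, uniform continuity of the clamped [h] controls
    the difference; elsewhere boundedness and a vanishing probability do. Together with the
    convergence for [V] this makes three errors of [e / 3]. *)
Lemma cvg_clamp_slutsky (X V : R -> Om -> 'rV[R]_n) h K (l : R) :
  continuous h -> 0 <= K ->
  (forall T, S T -> measurable_rV (X T)) -> (forall T, S T -> measurable_rV (V T)) ->
  cvg_prob0 P S (fun T w => \sum_j `|X T w ord0 j - V T w ord0 j|) ->
  cvg_along S (fun T => \int[P]_w (h (clamp K (V T w)))%:E)%E l%:E ->
  cvg_along S (fun T => \int[P]_w (h (clamp K (X T w)))%:E)%E l%:E.
Proof.
move=> ch K0 mX mV cD cV.
have mD : measurable_along S (fun T w => \sum_j `|X T w ord0 j - V T w ord0 j|).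
  move=> T ST; apply: measurable_sum => j; apply: measurableT_comp => //.
  by apply: measurable_funB; [exact: mX|exact: mV].
apply/cvg_alongP => [T ST|e e0].
  by apply: integral_fin_num; apply: integrable_clamp => //; exact: mX.
have [M HM] := clamp_bounded ch K0.
have M0 : 0 <= M by apply: le_trans (HM 0).
have e3 : 0 < e / 3 by rewrite divr_gt0.
have [dt dt0 Hdt] := clamp_uniform ch K0 e3.
(* The denominator [2 * M + 1] keeps the contribution of the exceptional event below [e / 3], also
   when [M = 0]. *)
have /(cvg_prob0P P mD)/(_ (dt / 2) (e / 3 / (2 * M + 1))) := cD.
have eta0 : 0 < e / 3 / (2 * M + 1) by rewrite divr_gt0// ltr_wpDl// mulr_ge0.
rewrite eta0 divr_gt0// => /(_ isT isT) HP.
have fV T : S T -> (\int[P]_w (h (clamp K (V T w)))%:E)%E \is a fin_num.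
  by move=> ST; apply: integral_fin_num; apply: integrable_clamp => //; exact: mV.
have /(cvg_alongP l fV)/(_ (e / 3) e3) HV := cV.
have ST : along S S by exists 0.
apply: filterS3 ST HP HV => T ST /= HP HV.
set D := (fun w => \sum_j `|X T w ord0 j - V T w ord0 j|).
have Hw w : `|D w| <= dt / 2 -> `|h (clamp K (V T w)) - h (clamp K (X T w))| <= e / 3.
  move=> Dw; rewrite distrC; apply: Hdt => j.
  (* Halving [dt] turns the non-strict bound on [D] into the strict one asked by uniform
     continuity. *)
  apply: le_lt_trans (_ : dt / 2 < dt); last lra.
  apply: le_trans Dw; rewrite [leRHS]ger0_norm ?sumr_ge0//.
  by rewrite /D (bigD1 j)//= lerDl sumr_ge0.
have := @dist_Rintegral_le_prob _ _ _ P (fun w => h (clamp K (V T w)))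
  (fun w => h (clamp K (X T w))) D M (e / 3) (dt / 2)
  (measurable_fun_continuous_rV (continuous_clamp ch K0) (mV T ST))
  (measurable_fun_continuous_rV (continuous_clamp ch K0) (mX T ST))
  (mD T ST) (fun w => HM _) (fun w => HM _) (ltW e3) Hw.
rewrite -/(Rintegral P setT (fun w => h (clamp K (X T w)))).
move: HV; rewrite -/(Rintegral P setT (fun w => h (clamp K (V T w)))).
set a := Rintegral _ _ _; set b := Rintegral _ _ _; set pr := fine _ in HP *.
move=> la ab.
have Mp : 2 * M * pr <= e / 3.
  apply: (@le_trans _ _ ((2 * M + 1) * (e / 3 / (2 * M + 1)))).
    apply: ler_pM => //; [lra|exact: fine_ge0|lra].
  by rewrite mulrC divfK// gt_eqF// ltr_wpDl// mulr_ge0.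
rewrite (_ : l - b = (l - a) + (a - b)); last by ring.
by apply: le_trans (ler_normD _ _) _; lra.
Qed.

Lemma measurable_enorm_powR {d0} {Om0 : measurableType d0} (Z : Om0 -> 'rV[R]_n) m :
  0 < m -> measurable_rV Z -> measurable_fun setT (fun w => enorm (Z w) `^ m).
Proof.
move=> m0; exact: (measurable_fun_continuous_rV
  (continuous_powR_ge0 m0 (@continuous_enorm R n) (@enorm_ge0 R n))).
Qed.

(** Clamping decreases the norm, so the clamped moments of [X T] are at most [C]. The limit in [T]
    gives the same for [Y] at every level [K], and Fatou's lemma removes the clamp. *)
Lemma moment_limit_le (X : R -> Om -> 'rV[R]_n) (Y : Om' -> 'rV[R]_n) m (C : R) :
  (forall M : R, exists2 T, S T & M < T) -> 0 < m ->
  (forall T, S T -> measurable_rV (X T)) -> measurable_rV Y ->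
  (forall T, S T -> (\int[P]_w (enorm (X T w) `^ m)%:E <= C%:E)%E) ->
  (forall K, 0 <= K -> cvg_along S (fun T => \int[P]_w (enorm (clamp K (X T w)) `^ m)%:E)%E
     (\int[P']_w (enorm (clamp K (Y w)) `^ m)%:E)%E) ->
  (\int[P']_w (enorm (Y w) `^ m)%:E <= C%:E)%E.
Proof.
move=> Su m0 mX mY bX cXY.
have cm := continuous_powR_ge0 m0 (@continuous_enorm R n) (@enorm_ge0 R n).
have bK K : 0 <= K -> (\int[P']_w (enorm (clamp K (Y w)) `^ m)%:E <= C%:E)%E.
  move=> K0; have iY := integral_fin_num (integrable_clamp P' cm K0 mY).
  rewrite -(fineK iY) lee_fin; apply/ler_addgt0Pr => e e0.
  have fX T : S T -> (\int[P]_w (enorm (clamp K (X T w)) `^ m)%:E)%E \is a fin_num.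
    by move=> ST; apply: integral_fin_num; exact: (integrable_clamp P cm K0 (mX T ST)).
  have := cXY K K0; rewrite -(fineK iY) => /(cvg_alongP _ fX).
  (* Unboundedness of [S] supplies an actual index beyond [T0] at which the eventual bound can be
     evaluated. *)
  move=> /(_ e e0)[T0 HT0]; have [T ST T0T] := Su T0.
  have := HT0 T ST (ltW T0T); rewrite /= ler_norml => /andP[_ H].
  suff : fine (\int[P]_w (enorm (clamp K (X T w)) `^ m)%:E)%E <= C by lra.
  rewrite -lee_fin (fineK (fX T ST)); apply: le_trans (bX T ST).
  apply: ge0_le_integral => //.
  - by move=> w _; rewrite lee_fin powR_ge0.
  - apply/measurable_EFinP.
    exact: (measurable_fun_continuous_rV (continuous_clamp cm K0) (mX T ST)).
  - apply/measurable_EFinP; exact: measurable_enorm_powR (mX T ST).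
  - move=> w _; rewrite lee_fin; apply: ge0_ler_powR; rewrite ?nnegrE ?enorm_ge0 ?(ltW m0)//.
    exact: enorm_clamp_le.
pose F (k : nat) (w : Om') : \bar R := (enorm (clamp k%:R (Y w)) `^ m)%:E.
(* For fixed [w] the sequence is constant once [k] reaches the norm of [Y w]. *)
have cF w : F k w @[k --> \oo] --> (enorm (Y w) `^ m)%:E.
  apply: cvg_near_cst; near=> k; rewrite /F clamp_id// => j.
  apply: le_trans (normr_le_enorm _ _) _; near: k; exact: nbhs_infty_ger.
have mF k : measurable_fun setT (F k).
  apply/measurable_EFinP.
  exact: (measurable_fun_continuous_rV (continuous_clamp cm (ler0n _ k)) mY).
have F0 k w : setT w -> (0 <= F k w)%E by rewrite lee_fin powR_ge0.
have := fatou P' measurableT mF F0.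
under eq_integral do rewrite (cvg_limn_einf_sup (cF _)).1.
move=> /le_trans; apply.
rewrite limn_einf_lim; apply: lime_le; first exact: is_cvg_einfs.
by near=> k; apply: le_trans (bK k%:R (ler0n _ _)); apply: ereal_inf_lbound; exists k => /=.
Unshelve. all: by end_near. Qed.

(** * Truncation error under the growth condition *)

Section truncation.
Context {d0} {Om0 : measurableType d0} (Q : probability Om0 R).
Variables (Z : Om0 -> 'rV[R]_n) (f : 'rV[R]_n -> R) (m C eps M K : R).
Hypotheses (cf : continuous f) (m0 : 0 < m) (eps0 : 0 <= eps) (K0 : 0 <= K)
  (MK : M < K) (mZ : measurable_rV Z)
  (bZ : (\int[Q]_w (enorm (Z w) `^ m)%:E <= C%:E)%E)
  (growth : forall u, M < enorm u -> `|f u| <= eps * enorm u `^ m).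

(** Either clamping does nothing, or [u] and its clamp both have norm at least [K > M]; the growth
    bound then applies to each, and the clamp has the smaller norm. *)
Lemma dist_clamp_le u : `|f u - f (clamp K u)| <= 2 * eps * enorm u `^ m.
Proof.
have [->|uK] := eqVneq (clamp K u) u.
  by rewrite subrr normr0 !mulr_ge0// powR_ge0.
have Ku := enorm_clamp_ge K0 uK.
have cu := enorm_clamp_le u K0.
have H1 : `|f u| <= eps * enorm u `^ m by apply: growth; exact: lt_le_trans MK (le_trans Ku cu).
have H2 : `|f (clamp K u)| <= eps * enorm u `^ m.
  apply: le_trans (growth (lt_le_trans MK Ku)) _.
  by rewrite ler_wpM2l//; apply: ge0_ler_powR; rewrite ?nnegrE ?enorm_ge0 ?(ltW m0).
by apply: le_trans (ler_normB _ _) _; lra.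
Qed.

Let imom : Q.-integrable setT (EFin \o (fun w => 2 * eps * enorm (Z w) `^ m)).
Proof.
have i1 : Q.-integrable setT (EFin \o (fun w => enorm (Z w) `^ m)).
  apply/integrableP; split; first exact/measurable_EFinP/measurable_enorm_powR.
  apply: le_lt_trans (ltry C); apply: le_trans bZ.
  by under eq_integral do rewrite /= ger0_norm ?powR_ge0//.
have := integrableZl measurableT (2 * eps) i1.
by apply: eq_integrable => // w _; rewrite /= EFinM.
Qed.

(** The growth bound is silent inside the ball of radius [M], so [f] is split into
    [f - f \o clamp K], dominated by the [m]-th moment, and the bounded [f \o clamp K]. *)
Lemma integrable_growth : Q.-integrable setT (EFin \o (fun w => f (Z w))).
Proof.
have mf : measurable_fun setT (fun w => f (Z w)).
  exact: measurable_fun_continuous_rV.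
have iB : Q.-integrable setT (EFin \o (fun w => f (Z w) - f (clamp K (Z w)))).
  apply: le_integrable imom => //.
    apply/measurable_EFinP; apply: measurable_funB => //.
    exact: (measurable_fun_continuous_rV (continuous_clamp cf K0)).
  move=> w _ /=; rewrite lee_fin; apply: le_trans (dist_clamp_le _) _.
  exact: ler_norm.
have := integrableD measurableT iB (integrable_clamp Q cf K0 mZ).
by apply: eq_integrable => // w _; rewrite /= -EFinD subrK.
Qed.

Lemma dist_Rintegral_clamp_le :
  `|\int[Q]_w f (Z w) - \int[Q]_w f (clamp K (Z w))| <= 2 * eps * C.
Proof.
apply: le_trans (dist_Rintegral_le integrable_growth (integrable_clamp Q cf K0 mZ)
  imom (fun w => dist_clamp_le _)) _.
rewrite -lee_fin fineK; last exact: integral_fin_num.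
under eq_integral do rewrite EFinM.
rewrite ge0_integralZl_EFin//; last 3 first.
- by move=> w _; rewrite lee_fin powR_ge0.
- exact/measurable_EFinP/measurable_enorm_powR.
- by rewrite mulr_ge0.
by rewrite [leRHS]EFinM lee_wpmul2l// lee_fin mulr_ge0.
Qed.

End truncation.

(** Three-term estimate: the clamping errors of [X T] and [Y] are small uniformly in [T], and the
    clamped expectations converge by hypothesis. The moment bound on [Y] is inherited from that on
    [X T]. *)
Lemma cvg_moments (X : R -> Om -> 'rV[R]_n) (Y : Om' -> 'rV[R]_n) m (C : R) f :
  (forall M : R, exists2 T, S T & M < T) -> 0 < m ->
  (forall T, S T -> measurable_rV (X T)) -> measurable_rV Y ->
  (forall T, S T -> (\int[P]_w (enorm (X T w) `^ m)%:E <= C%:E)%E) ->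
  (forall h K, continuous h -> 0 <= K ->
     cvg_along S (fun T => \int[P]_w (h (clamp K (X T w)))%:E)%E
     (\int[P']_w (h (clamp K (Y w)))%:E)%E) ->
  continuous f ->
  (forall eps : R, 0 < eps -> exists M : R, forall u,
      M < enorm u -> `|f u| <= eps * enorm u `^ m) ->
  cvg_along S (fun T => \int[P]_w (f (X T w))%:E)%E (\int[P']_w (f (Y w))%:E)%E.
Proof.
move=> Su m0 mX mY bX cXY cf gf.
have cm := continuous_powR_ge0 m0 (@continuous_enorm R n) (@enorm_ge0 R n).
have bY : (\int[P']_w (enorm (Y w) `^ m)%:E <= C%:E)%E.
  by apply: (moment_limit_le Su m0 mX mY bX) => K K0; exact: cXY _ _ cm K0.
have C0 : 0 <= C.
  rewrite -lee_fin; apply: le_trans bY; apply: integral_ge0 => w _.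
  by rewrite lee_fin powR_ge0.
have [M1 gM1] := gf 1 ltr01.
have ifin d0 (Om0 : measurableType d0) (Q : probability Om0 R) Z :
    measurable_rV Z -> (\int[Q]_w (enorm (Z w) `^ m)%:E <= C%:E)%E ->
    (\int[Q]_w (f (Z w))%:E)%E \is a fin_num.
  move=> mZ bZ; apply: integral_fin_num.
  apply: (@integrable_growth _ _ Q Z f m C 1 M1 (Num.max 0 (M1 + 1))) => //.
    by rewrite le_max lexx.
  by rewrite lt_max ltrDl ltr01 orbT.
rewrite -(fineK (ifin _ _ P' Y mY bY)).
apply/cvg_alongP => [T ST|e e0].
  by apply: ifin; [exact: mX|exact: bX].
(* [C + 1] keeps the denominator positive when [C = 0]; the factor [6] makes each clamping error
   [2 * eps * C] at most [e / 3]. *)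
have C1 : 0 < 6 * (C + 1) by rewrite mulr_gt0// ltr_wpDl.
pose eps := e / (6 * (C + 1)).
have eps0 : 0 < eps by rewrite divr_gt0.
have epsC : 2 * eps * C <= e / 3.
  have -> : e / 3 = 2 * eps * (C + 1) by rewrite /eps; field; rewrite gt_eqF//; lra.
  by rewrite ler_wpM2l//; [rewrite mulr_ge0// ltW|lra].
have [M gM] := gf eps eps0.
pose K := Num.max 0 (M + 1).
have K0 : 0 <= K by rewrite le_max lexx.
have MK : M < K by rewrite lt_max ltrDl ltr01 orbT.
have iYc := integral_fin_num (integrable_clamp P' cf K0 mY).
have fX T : S T -> (\int[P]_w (f (clamp K (X T w)))%:E)%E \is a fin_num.
  by move=> ST; apply: integral_fin_num; exact: (integrable_clamp P cf K0 (mX T ST)).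
have e3 : 0 < e / 3 by rewrite divr_gt0.
have := cXY f K cf K0; rewrite -(fineK iYc) => /(cvg_alongP _ fX)/(_ _ e3) Hc.
have ST : along S S by exists 0.
apply: filterS2 ST Hc => T ST /= Hc.
have dY := dist_Rintegral_clamp_le cf m0 (ltW eps0) K0 MK mY bY gM.
have dX := dist_Rintegral_clamp_le cf m0 (ltW eps0) K0 MK (mX T ST) (bX T ST) gM.
move: Hc dY dX; rewrite /Rintegral.
set a := fine _; set b := fine _; set a' := fine _; set b' := fine _.
move=> ab a'a b'b; rewrite (_ : a' - b' = (a' - a) + (a - b) - (b' - b)); last by ring.
apply: le_trans (ler_normB _ _) _; have := ler_normD (a' - a) (a - b); lra.
Qed.

End limits.

(** * Measurability of the matrix inverse *)

(** Writing the inverse of [f] as [f] times the power [-1] of [f ^+ 2] reduces the claim to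
    measurability of real powers; at zeros of [f] both sides are [0]. *)
Lemma measurable_inv {d} {T : measurableType d} {R : realType} (f : T -> R) :
  measurable_fun setT f -> measurable_fun setT (fun w => (f w)^-1).
Proof.
move=> mf; rewrite (_ : (fun w => _) = (fun w => f w * (f w ^+ 2) `^ (-1))).
  apply: measurable_funM => //.
  apply: (measurableT_comp (measurable_powR (-1))).
  exact: measurable_funX.
apply/funext => w; rewrite powR_inv1 ?sqr_ge0//.
have [->|fw] := eqVneq (f w) 0; first by rewrite invr0 mul0r.
by field.
Qed.

Section measurable_matrix.
Context {d} {T : measurableType d} {R : realType}.

Lemma measurable_det n (A : T -> 'M[R]_n) :
  (forall i j, measurable_fun setT (fun w => A w i j)) ->
  measurable_fun setT (fun w => \det (A w)).
Proof.
move=> mA; apply: measurable_sum => s; apply: measurable_funM => //.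
by apply: measurable_prod => i _; exact: mA.
Qed.

(** Entries of the inverse are cofactors over the determinant. Singular matrices are split off
    because [invmx] returns its argument there. *)
Lemma measurable_invmx n (A : T -> 'M[R]_n) :
  (forall i j, measurable_fun setT (fun w => A w i j)) ->
  forall i j, measurable_fun setT (fun w => invmx (A w) i j).
Proof.
move=> mA i j.
rewrite (_ : (fun w => _) = (fun w => if \det (A w) == 0 then A w i j else
    (\det (A w))^-1 * ((-1) ^+ (j + i) * \det (row' j (col' i (A w)))))).
  apply: measurable_fun_ifT => //.
    by apply: measurable_fun_eqr; [exact: measurable_det|exact: measurable_cst].
  apply: measurable_funM; first exact/measurable_inv/measurable_det.
  apply: measurable_funM => //; apply: measurable_det => k l.
  by under eq_fun do rewrite !mxE; exact: mA.
apply/funext => w; rewrite /invmx unitmxE unitfE.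
by case: eqP => //= _; rewrite !mxE.
Qed.

End measurable_matrix.

(** * Restriction to coordinates and extension by zero *)

Section subvector.
Context {R : realType} {n : nat} (J : {set 'I_n}).

Lemma extv_notin (v : 'rV[R]_#|J|) j : j \notin J -> extv J v ord0 j = 0.
Proof. by move=> jJ; rewrite mxE; case: {-}_ / boolP => // h; rewrite h in jJ. Qed.

Lemma extv_in (v : 'rV[R]_#|J|) j (jJ : j \in J) :
  extv J v ord0 j = v ord0 (enum_rank_in jJ j).
Proof.
rewrite mxE; case: {-}_ / boolP => [h|]; last by rewrite jJ.
(* The rank is built from a membership proof; injectivity of [enum_val] identifies the ranks coming
   from two such proofs. *)
by congr (v _ _); apply: enum_val_inj; rewrite !enum_rankK_in.
Qed.

Lemma extv_subv (u : 'rV[R]_n) j :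
  extv J (subv J u) ord0 j = if j \in J then u ord0 j else 0.
Proof.
case: ifPn => [jJ|]; last exact: extv_notin.
by rewrite extv_in mxE enum_rankK_in.
Qed.

Lemma continuous_extv : continuous (@extv R n J).
Proof.
move=> v A /nbhs_ballP[e /= e0 eA]; apply/nbhs_ballP; exists e => //= v' [_ vv'].
apply: eA; split=> // i j; rewrite (ord1 i).
have [jJ|jJ] := boolP (j \in J); first by rewrite !extv_in; exact: vv'.
by rewrite !extv_notin//; exact: ballxx.
Qed.

End subvector.

Lemma mulmx_inv_diag {R : fieldType} n (u a : 'rV[R]_n) :
  (forall j, a ord0 j != 0) ->
  u *m invmx (diag_mx a) = \row_j (u ord0 j / a ord0 j).
Proof.
move=> a0; set v := \row_j _.
have aU : diag_mx a \in unitmx.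
  by rewrite unitmxE det_diag unitfE; apply/prodf_neq0.
have -> : u = v *m diag_mx a.
  by apply/rowP => j; rewrite mul_mx_diag !mxE divfK.
by rewrite mulmxK.
Qed.

(** * Convergence of moments of the penalized estimator *)

Theorem theorem7
  (R : realType) (p : nat)
  (* parameter space *)
  (Theta : set 'rV[R]_p) (theta_star : 'rV[R]_p)
  (hTheta_open : open Theta) (hTheta_bdd : bounded_set Theta)
  (htheta_star : Theta theta_star)
  (* probability space *)
  (d : measure_display) (Om : measurableType d) (P : probability Om R)
  (* index set TT, subset of [0,oo) with sup TT = oo *)
  (TT : set R) (hTT_nonneg : forall T, TT T -> 0 <= T)
  (hTT_unbdd : forall M : R, exists2 T, TT T & M < T)
  (* random fields H_T, continuous in theta *)
  (H : R -> Om -> 'rV[R]_p -> R)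
  (hH_meas : forall T, TT T -> forall th, closure Theta th ->
     measurable_fun setT (fun w => H T w th))
  (hH_cont : forall T, TT T -> forall w, {within closure Theta, continuous (H T w)})
  (* penalty p_T(theta) = sum_j xi_T^j pen(theta_j) *)
  (xi : R -> Om -> 'I_p -> R)
  (hxi_pos : forall T, TT T -> forall w j, 0 < xi T w j)
  (hxi_meas : forall T, TT T -> forall j, measurable_fun setT (fun w => xi T w j))
  (pen : R -> R) (hpen_nonneg : forall x, 0 <= pen x) (hpen0 : pen 0 = 0)
  (* the penalized estimator *)
  (theta_hat : R -> Om -> 'rV[R]_p)
  (htheta_hat_meas : forall T, TT T -> forall j,
     measurable_fun setT (fun w => theta_hat T w ord0 j))
  (htheta_hat_in : forall T, TT T -> forall w, closure Theta (theta_hat T w))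
  (htheta_hat_max : forall T, TT T -> forall w th, closure Theta th ->
     H T w th - \sum_(j < p) xi T w j * pen (th ord0 j)
     <= H T w (theta_hat T w) - \sum_(j < p) xi T w j * pen (theta_hat T w ord0 j))
  (* rate matrix a_T = diag(alpha_T) *)
  (alpha : R -> 'I_p -> R)
  (halpha_inv : forall T, TT T -> forall j, alpha T j != 0)
  (halpha_cvg : cvg_along TT (fun T => `| diag_mx (\row_(j < p) alpha T j) |) 0)
  (* exponents *)
  (q m : R) (hq0 : 0 < q) (hq1 : q <= 1) (hm : 0 < m)
  (* limit objects on a probability space (Om', P') *)
  (d' : measure_display) (Om' : measurableType d') (P' : probability Om' R)
  (Delta : Om' -> 'rV[R]_p)
  (hDelta_meas : forall j, measurable_fun setT (fun w => Delta w ord0 j))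
  (Gamma : Om' -> 'M[R]_p)
  (hGamma_meas : forall i j, measurable_fun setT (fun w => Gamma w i j))
  (hGamma_pd : {ae P', forall w, posdef (Gamma w)})
  (psi1 : 'rV[R]_#|[set j : 'I_p | theta_star ord0 j != 0]%SET|) :
  let J0 := [set j : 'I_p | theta_star ord0 j == 0]%SET in
  let J1 := [set j : 'I_p | theta_star ord0 j != 0]%SET in
  let uhat := fun T w => (theta_hat T w - theta_star) *m invmx (diag_mx (\row_(j < p) alpha T j)) in
  let Y1 := fun w => (subv J1 (Delta w) - psi1) *m invmx (subm J1 (Gamma w))^T in
  let utilde := fun w => extv J1 (Y1 w) in
  (* moment bound *)
  (exists C : R, forall T, TT T ->
     (\int[P]_w ((enorm (uhat T w)) `^ m)%:E <= C%:E)%E) ->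
  (* [A6] *)
  (forall j, j \in J0 ->
     cvg_prob0 P TT (fun T w => xi T w j `^ (- q^-1) * `| alpha T j |^-1)) ->
  (* (tilde a_T^(00))^{-1} (theta_hat^(0) - theta*^(0)) -> 0 in probability *)
  cvg_prob0 P TT (fun T w => enorm_on J0
      (\row_(j < p) (xi T w j `^ (q^-1) * (theta_hat T w ord0 j - theta_star ord0 j)))) ->
  (* (tilde a_T^(11))^{-1} (theta_hat^(1) - theta*^(1)) -> Y1 in distribution *)
  cvg_dist P P' TT
      (fun T w => subv J1 (\row_(j < p) ((theta_hat T w ord0 j - theta_star ord0 j) / alpha T j)))
      Y1 ->
  forall f : 'rV[R]_p -> R, continuous f ->
  (forall eps : R, 0 < eps -> exists M : R, forall u,
      M < enorm u -> `| f u | <= eps * (enorm u) `^ m) ->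
  cvg_along TT (fun T => (\int[P]_w (f (uhat T w))%:E)%E)
                (\int[P']_w (f (utilde w))%:E)%E.
Proof.
move=> J0 J1 uhat Y1 utilde [C bC] A6 cJ0 cJ1 f cf gf.
have uhatE T w : TT T -> uhat T w =
    \row_j ((theta_hat T w ord0 j - theta_star ord0 j) / alpha T j).
  move=> ST; rewrite /uhat mulmx_inv_diag.
    by apply/rowP => j; rewrite !mxE.
  by move=> j; rewrite mxE; exact: halpha_inv.
pose u T w : 'rV[R]_p :=
  \row_j ((theta_hat T w ord0 j - theta_star ord0 j) / alpha T j).
pose V T w : 'rV[R]_p := extv J1 (subv J1 (u T w)).
have mdiff T : TT T -> forall j,
    measurable_fun setT (fun w => theta_hat T w ord0 j - theta_star ord0 j).
  by move=> ST j; apply: measurable_funB => //; exact: htheta_hat_meas.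
have mu T : TT T -> measurable_rV (u T).
  move=> ST j; under eq_fun do rewrite mxE.
  by apply: measurable_funM => //; exact: mdiff.
have muhat T : TT T -> measurable_rV (uhat T).
  move=> ST; rewrite (_ : uhat T = u T); first exact: mu.
  by apply/funext => w; exact: uhatE.
have mV T : TT T -> measurable_rV (V T).
  move=> ST j; under eq_fun do rewrite /V extv_subv.
  by case: (j \in J1); [exact (mu T ST j)|exact: measurable_cst].
have mY : measurable_rV utilde.
  move=> j; have [jJ|jJ] := boolP (j \in J1); last first.
    by under eq_fun do rewrite /utilde (extv_notin _ jJ); exact: measurable_cst.
  under eq_fun do rewrite /utilde extv_in !mxE.
  apply: measurable_sum => i; apply: measurable_funM.
    by under eq_fun do rewrite !mxE; apply: measurable_funB => //; exact: hDelta_meas.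
  apply: measurable_invmx => k l; under eq_fun do rewrite !mxE; exact: hGamma_meas.
have mxi T (a : R) : TT T -> forall j, measurable_fun setT (fun w => xi T w j `^ a).
  by move=> ST j; apply: (measurableT_comp (measurable_powR a)); exact: hxi_meas.
have cD : cvg_prob0 P TT (fun T w => \sum_j `|uhat T w ord0 j - V T w ord0 j|).
  have mdist j : measurable_along TT (fun T w => `|uhat T w ord0 j - V T w ord0 j|).
    move=> T ST; apply: measurableT_comp => //.
    by apply: measurable_funB; [exact: muhat T ST j|exact: mV T ST j].
  apply: (cvg_prob0_sum mdist) => j; pose E T w := enorm_on J0 (\row_(j < p)
    (xi T w j `^ (q^-1) * (theta_hat T w ord0 j - theta_star ord0 j))).
  pose B T w := xi T w j `^ (- q^-1) * `|alpha T j|^-1.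
  have mE : measurable_along TT E.
    move=> T ST; apply: (measurable_fun_continuous_rV (@continuous_enorm_on R p J0)).
    move=> i; under eq_fun do rewrite mxE.
    by apply: measurable_funM; [exact: mxi|exact: mdiff].
  have mB : measurable_along TT B.
    by move=> T ST; apply: measurable_funM => //; exact: mxi.
  have [jJ|jJ] := boolP (j \in J0); last first.
    (* Outside [J0] the difference vanishes identically, so any family tending to [0] in probability
       dominates it. *)
    have jJ1 : j \in J1 by move: jJ; rewrite !inE.
    apply: (cvg_prob0_le mE (mdist j) _ cJ0) => T w ST.
    by rewrite uhatE// /V extv_subv jJ1 subrr !normr0.
  (* The powers of [xi] cancel: [|u_j|] is [xi^(1/q) |theta_hat_j - theta_star_j|], at most [E],
     times [xi^(-1/q) / |alpha_j|], which is [B]. Both [E] and [B] tend to [0] in probability. *)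
  apply: (cvg_prob0_le _ (mdist j) _ (cvg_prob0M mE mB cJ0 (A6 j jJ))).
    by move=> T ST; apply: measurable_funM; [exact: mE|exact: mB].
  move=> T w ST; rewrite normr_id uhatE// /V extv_subv.
  have -> : (j \in J1) = false by move: jJ; rewrite !inE => ->.
  rewrite subr0 mxE normrM normfV.
  have xq : xi T w j `^ q^-1 * xi T w j `^ (- q^-1) = 1.
    by rewrite powRN mulfV// gt_eqF// powR_gt0// hxi_pos.
  have dE : `|xi T w j `^ q^-1 * (theta_hat T w ord0 j - theta_star ord0 j)| <= E T w.
    rewrite -sqrtr_sqr ler_wsqrtr// (bigD1 j)//= mxE lerDl.
    by apply: sumr_ge0 => i _; exact: sqr_ge0.
  apply: le_trans (ler_norm _); rewrite /B mulrA ler_wpM2r ?invr_ge0//.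
  apply: le_trans (ler_wpM2r (powR_ge0 _ _) dE).
  by rewrite normrM (ger0_norm (powR_ge0 _ _)) mulrAC xq mul1r.
apply: (cvg_moments hTT_unbdd hm muhat mY bC) => // h K ch K0.
have iY := integral_fin_num (integrable_clamp P' ch K0 mY).
rewrite -(fineK iY); apply: (cvg_clamp_slutsky ch K0 muhat mV cD); rewrite fineK//.
have [M HM] := clamp_bounded ch K0.
(* [V] is the zero extension of the subvector that converges in distribution, so composing with
   [extv J1] gives the bounded continuous test function. *)
apply: (cJ1 (fun v => h (clamp K (extv J1 v)))).
  move=> v; apply: (@continuous_comp _ _ _ (extv J1) (fun x => h (clamp K x))).
    exact: continuous_extv.
  exact: continuous_clamp.
by exists M.
Qed.
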